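(* Let $G$ be a simple graph and let $M\in\{A(G),L(G),Q(G)\}$. Suppose that, for some ordering of the vertices of $G$ and some partition into $k$ blocks of sizes $n_1,\dots,n_k$, $M$ is written in block form with diagonal blocks $M_j$ ($n_j\times n_j$, symmetric), blocks $C_{ij}$ in position $(i,j)$ and $C_{ij}^T$ in position $(j,i)$ for $i<j$, and that there exist nonzero vectors $\mathbf{w}_j\in\mathbb{R}^{n_j}$, $1\le j\le k$, and real scalars $\lambda_j,\alpha_{ij},\beta_{ij}$ such that $$M_j\mathbf{w}_j=\lambda_j\mathbf{w}_j\ (1\le j\le k),\qquad C_{ij}\mathbf{w}_j=\alpha_{ij}\mathbf{w}_i,\qquad C_{ij}^T\mathbf{w}_i=\beta_{ij}\mathbf{w}_j\quad (1\le i<j\le k).$$ Let $\mathbf{u}_j=[0,\ldots,0,\mathbf{w}_j,0,\ldots,0]^T$, where $\mathbf{w}_j$ occupies the $j$th block, and suppose each $\mathbf{u}_j$ is a unit vector. Define $$S=\{v\in V(G) : (\mathbf{u}_j)_v=0\ \text{ for all } 1\le j\le k\}.$$ If $G$ is an induced subgraph of a simple graph $X$ such that every vertex of $G$ having a neighbour in $V(X)\setminus V(G)$ belongs to $S$, then, for distinct $a,b\in\{1,\dots,k\}$, $G$ exhibits fractional revival from $\mathbf{u}_a$ to $\mathbf{u}_b$ (with respect to $M$) if and only if $X$ exhibits fractional revival from $[\mathbf{u}_a,\mathbf{0}]^T$ to $[\mathbf{u}_b,\mathbf{0}]^T$ (with respect to the matrix of $X$ of the same type: adjacency, Laplacian,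 or signless Laplacian, respectively).
   Context: For a finite simple graph, $A$ is the adjacency matrix, $D$ the diagonal degree matrix, $L=D-A$ the Laplacian and $Q=D+A$ the signless Laplacian. For a real symmetric matrix $N$ associated with a graph, $U_N(t)=\exp(itN)$. For linearly independent states $\mathbf{u},\mathbf{v}$, the graph exhibits fractional revival from $\mathbf{u}$ to $\mathbf{v}$ (with respect to $N$) if there exist a time $\tau$ and complex scalars $\alpha,\beta$ with $\beta\neq0$ such that $U_N(\tau)\mathbf{u}=\alpha\mathbf{u}+\beta\mathbf{v}$. $[\mathbf{u},\mathbf{0}]^T$ denotes the vector on $V(X)$ equal to $\mathbf{u}$ on $V(G)$ and $0$ on $V(X)\setminus V(G)$. *)

(* Defs.v *)
From HB Require Import structures.
From mathcomp Require Import all_boot all_order all_algebra.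
From mathcomp Require Import complex.
From mathcomp Require Import all_classical all_reals topology normedtype sequences.

Set Implicit Arguments.
Unset Strict Implicit.
Unset Printing Implicit Defensive.

Import Order.TTheory GRing.Theory Num.Theory.
Import numFieldNormedType.Exports.

Local Open Scope ring_scope.
Local Open Scope complex_scope.

Record sgraph := SGraph {
  vertex :> finType;
  adj : rel vertex;
  adj_sym : symmetric adj;
  adj_irrefl : irreflexive adj }.

(* Matrices and vectors on the vertices of G are indexed by 'I_#|G|, through
   the canonical enumeration of G (enum_val / enum_rank). *)
Section GraphMatrices.
Variables (R : pzRingType) (G : sgraph).

Definition adjacency_mx : 'M[R]_#|G| :=
  \matrix_(i, j) (adj (enum_val i) (enum_val j))%:R.

Definition degree_mx : 'M[R]_#|G| :=
  diag_mx (\row_i #|[set y : G | adj (enum_val i) y]|%:R).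

Definition laplacian_mx : 'M[R]_#|G| := degree_mx - adjacency_mx.

Definition signless_laplacian_mx : 'M[R]_#|G| := degree_mx + adjacency_mx.

End GraphMatrices.

Variant graph_mx_kind := Adjacency | Laplacian | SignlessLaplacian.

Definition graph_mx (R : pzRingType) (c : graph_mx_kind) (G : sgraph) :
    'M[R]_#|G| :=
  match c with
  | Adjacency => adjacency_mx R G
  | Laplacian => laplacian_mx R G
  | SignlessLaplacian => signless_laplacian_mx R G
  end.

(* The limit is entrywise, in the norm topology of K. *)
Definition exp_mx (K : numFieldType) (n : nat) (A : 'M[K]_n) : 'M[K]_n :=
  \matrix_(i, j) limn (series (fun m : nat => (A ^+ m) i j / m`!%:R)).

Section Revival.
Variable R : realType.

Definition complexify (m n : nat) (A : 'M[R]_(m, n)) : 'M[R[i]]_(m, n) :=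
  map_mx (real_complex R) A.

Definition transition_mx (n : nat) (N : 'M[R]_n) (t : R) : 'M[R[i]]_n :=
  exp_mx ((0 +i* t) *: complexify N).

(* Linear independence of the two states is part of the predicate, since the
   notion is only meaningful for such pairs. *)
Definition fractional_revival (n : nat) (N : 'M[R]_n) (u v : 'cV[R[i]]_n) :
    Prop :=
  free [:: u; v] /\
  exists (tau : R) (alpha beta : R[i]),
    beta != 0 /\ transition_mx N tau *m u = alpha *: u + beta *: v.

End Revival.

Section Blocks.
Variables (R : pzRingType) (G : sgraph) (k : nat) (n : 'I_k -> nat).

(* pos v is the position of v in the chosen ordering of the vertices. *)
Variable pos : G -> 'I_(\sum_j n j).

Definition block_state (w : forall j, 'cV[R]_(n j)) (j : 'I_k) : 'cV[R]_#|G| :=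
  rowsub (pos \o enum_val) (\mxcol_i ((i == j)%:R *: w i)).

End Blocks.

Definition common_zeros (R : pzRingType) (G : sgraph) (k : nat)
    (u : 'I_k -> 'cV[R]_#|G|) : {set G} :=
  [set v : G | [forall j, u j (enum_rank v) 0 == 0]].

(* f identifies G with an induced subgraph of X. *)
Definition induced_subgraph (G X : sgraph) (f : G -> X) : Prop :=
  injective f /\ forall x y : G, adj (f x) (f y) = adj x y.

Definition extend_by_zero (R : pzRingType) (G X : sgraph) (f : G -> X)
    (u : 'cV[R]_#|G|) : 'cV[R]_#|X| :=
  \col_i (if [pick v : G | f v == enum_val i] is Some v
          then u (enum_rank v) 0 else 0).

(* Main.v *)
Require Import Defs.
From mathcomp Require Import all_boot all_order all_algebra.
From mathcomp Require Import complex.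
From mathcomp Require Import all_classical all_reals topology normedtype.
From mathcomp Require Import sequences.

(** Let [U] be the matrix whose columns are the states [u_1, ..., u_k]. The
    block equations say that the span of these states is invariant under the
    matrix [M_G] of [G]: there is a [k]-by-[k] matrix [B] with [M_G U = U B]
    ([mul_block_state], [mul_state_mx]).

    Let [E] be the 0-1 matrix of extension by zero from [G] to [X]. A column
    of [M_X E] differs from the same column of [E M_G] only if it is indexed by
    a vertex of [G] with a neighbour outside [G]: such a neighbour contributes
    entries in the rows outside [G] and, for the Laplacians, changes the degree
    on the diagonal. All the states vanish at these vertices, so that
    [M_X E U = E M_G U] ([graph_mx_extension]), and therefore [M_X (E U) = (E U) B]: both graphs
    act on their states through the same small matrix [B].

    An intertwining relation [A P = P B] passes to all powers, hence to the
    exponentials ([exp_mx_intertwine]), so that the transition matrices satisfy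
    [T_G U = U T_B] and [T_X E U = E U T_B], that is, [T_X E u_a = E T_G u_a] at
    all times. Since [E] is left-invertible, the revival equation for [u_a] and
    [u_b] in [G] is equivalent to its image under [E], and linear independence
    is preserved both ways ([fractional_revival_transfer]).

    The exponential is an entrywise limit of partial sums, so the passage to
    exponentials rests on the convergence of these series over the complex
    numbers ([is_cvg_exp_mx]), obtained by domination by the real exponential
    series. *)

Set Implicit Arguments.
Unset Strict Implicit.
Unset Printing Implicit Defensive.

Import Order.TTheory GRing.Theory Num.Theory.
Import numFieldNormedType.Exports.

Local Open Scope ring_scope.
Local Open Scope complex_scope.

(** * Convergence of the matrix exponential *)

Lemma normr_real_complex (R : rcfType) (x : R) : `|x%:C| = `|x|%:C.
Proof. by rewrite normc_def /= expr0n addr0 sqrtr_sqr. Qed.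

Lemma normc_ge_Im (R : rcfType) (z : R[i]) : `|complex.Im z|%:C <= `|z|.
Proof.
rewrite normc_def lecR -sqrtr_sqr ler_wsqrtr // lerDr sqr_ge0 //.
Qed.

Lemma real_complex_continuous (R : realType) :
  continuous (real_complex R : R -> (R[i] : numFieldType)).
Proof.
move=> x; apply/cvgrPdist_lt => -[e e'] /= /[1!ltcE] /= /andP[/eqP-> e0].
near=> y.
rewrite -rmorphB normr_real_complex ltcR.
near: y.
by apply: cvgr_dist_lt.
Unshelve. all: end_near. Qed.

(** The real and imaginary parts of the terms are dominated too, so their
    series converge absolutely over the reals. *)
Lemma is_cvg_series_dominated (R : realType)
    (a : nat -> (R[i] : numFieldType)) (r : nat -> R) :
  (forall m, `|a m| <= (r m)%:C) -> cvgn (series r) -> cvgn (series a).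
Proof.
move=> ar cr.
have part (p : nat -> R) : (forall m, `|p m|%:C <= `|a m|) ->
    cvgn (series (fun m => (p m)%:C : (R[i] : numFieldType))).
  move=> pa.
  have cp : cvgn (series p).
    apply: normed_cvg; apply: series_le_cvg cr => m; first exact: normr_ge0.
      by rewrite -ler0c (le_trans _ (ar m)).
    by rewrite -lecR (le_trans (pa m) (ar m)).
  have -> : series (fun m => (p m)%:C) = real_complex R \o series p.
    by apply/funext => m; rewrite /series /= rmorph_sum.
  apply/cvg_ex; exists (limn (series p))%:C.
  by apply: continuous_cvg => //; exact: real_complex_continuous.
have -> : series a = series (fun m => (complex.Re (a m))%:C) \+
    (fun n => 'i * series (fun m => (complex.Im (a m))%:C) n).
  apply/funext => n; rewrite /series /= mulr_sumr -big_split /=.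
  by apply: eq_bigr => m _; rewrite [LHS]complexE.
apply: is_cvgD; first by apply: part => m; exact: normc_ge_Re.
by apply: is_cvgMr; apply: part => m; exact: normc_ge_Im.
Qed.

(** The sum of the moduli of all entries is a crude bound that dominates every
    column sum, which is what the induction on the exponent uses. *)
Lemma normr_expmx_le (K : numDomainType) (n : nat) (A : 'M[K]_n) m i j :
  `|(A ^+ m) i j| <= (\sum_k \sum_l `|A k l|) ^+ m.
Proof.
elim: m i j => [|m IH] i j.
  by rewrite !expr0 mxE; case: (_ == _); rewrite ?normr1 ?normr0.
have S0 : 0 <= \sum_k \sum_l `|A k l|.
  by apply: sumr_ge0 => k _; apply: sumr_ge0.
rewrite !exprSr mxE (le_trans (ler_norm_sum _ _ _)) //.
rewrite mulr_sumr ler_sum // => l _; rewrite normrM ler_pM //.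
by rewrite (bigD1 j) //= lerDl sumr_ge0.
Qed.

Lemma is_cvg_exp_mx (R : realType) (n : nat) (A : 'M[R[i]]_n) i j :
  cvgn (series (fun m : nat => (A ^+ m) i j / m`!%:R : (R[i] : numFieldType))).
Proof.
pose S : R := \sum_k \sum_l complex.Re `|A k l|.
have SE : S%:C = \sum_k \sum_l `|A k l|.
  rewrite rmorph_sum; apply: eq_bigr => k _; rewrite rmorph_sum.
  by apply: eq_bigr => l _; rewrite normc_def.
apply: (@is_cvg_series_dominated R _ (exp_coeff S)); last first.
  exact: is_cvg_series_exp_coeff.
move=> m; rewrite /exp_coeff /= normrM normfV normr_nat.
apply: (@le_trans _ _ (S%:C ^+ m / m`!%:R)); last first.
  by rewrite rmorphM rmorphXn fmorphV rmorph_nat.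
by rewrite SE ler_wpM2r ?invr_ge0 ?ler0n // normr_expmx_le.
Qed.

(** The relation passes from [A] and [B] to their powers, then to the partial
    sums of the exponential series; both sides are limits of one sequence of
    matrices, entry by entry. *)
Lemma exp_mx_intertwine (R : realType) (m n : nat) (A : 'M[R[i]]_m)
    (B : 'M[R[i]]_n) (P : 'M[R[i]]_(m, n)) :
  A *m P = P *m B -> exp_mx A *m P = P *m exp_mx B.
Proof.
move=> AP.
have AXP q : (A ^+ q) *m P = P *m (B ^+ q).
  elim: q => [|q IH]; first by rewrite !expr0 mul1mx mulmx1.
  by rewrite !exprSr -mulmxA AP mulmxA IH -mulmxA.
apply/matrixP => i j; rewrite !mxE.
pose s (x : nat) : (R[i] : numFieldType) :=
  \sum_k series (fun q => (A ^+ q) i k / q`!%:R) x * P k j.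
have sB : s = fun x => \sum_k P i k * series (fun q => (B ^+ q) k j / q`!%:R) x.
  apply/funext => x; rewrite /s /series /=.
  under eq_bigr do rewrite mulr_suml.
  under [RHS]eq_bigr do rewrite mulr_sumr.
  rewrite exchange_big [RHS]exchange_big; apply: eq_bigr => q _ /=.
  have /matrixP/(_ i j) := AXP q; rewrite !mxE => AXPij.
  under eq_bigr do rewrite mulrAC.
  under [RHS]eq_bigr do rewrite mulrA.
  by rewrite -!mulr_suml AXPij.
apply: (@norm_cvg_unique _ (R[i] : numFieldType) (s @ \oo)%classic).
  apply: cvg_big => [|k _]; first exact: add_continuous.
  rewrite mxE; apply: cvgMl.
  exact: is_cvg_exp_mx.
rewrite sB; apply: cvg_big => [|k _]; first exact: add_continuous.
  rewrite mxE; apply: cvgMr.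
exact: is_cvg_exp_mx.
Qed.

(** * Transfer of fractional revival along an embedding *)

Lemma complexifyM (R : realType) (m n p : nat) (A : 'M[R]_(m, n))
    (B : 'M[R]_(n, p)) : complexify (A *m B) = complexify A *m complexify B.
Proof. exact: map_mxM. Qed.

Lemma transition_mx_intertwine (R : realType) (m n : nat) (A : 'M[R]_m)
    (B : 'M[R]_n) (P : 'M[R]_(m, n)) (t : R) :
  A *m P = P *m B ->
  transition_mx A t *m complexify P = complexify P *m transition_mx B t.
Proof.
move=> AP; apply: exp_mx_intertwine.
by rewrite -scalemxAl -scalemxAr -!complexifyM AP.
Qed.

Lemma free_pair_mulmx (K : fieldType) (m n : nat) (E : 'M[K]_(m, n))
    (E' : 'M[K]_(n, m)) (u v : 'cV[K]_n) :
  E' *m E = 1%:M -> free [:: E *m u; E *m v] = free [:: u; v].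
Proof.
move=> E'E; have Einj : injective (mulmx E : 'cV_n -> 'cV_m).
  by apply: (can_inj (g := mulmx E')) => x; rewrite mulmxA E'E mul1mx.
rewrite !free_cons !nil_free !span_seq1 !span_nil !memv0 !andbT.
rewrite -[v == 0](inj_eq Einj) mulmx0; congr (~~ _ && _).
apply/vlineP/vlineP => -[c] cE; exists c.
  by apply: Einj; rewrite cE scalemxAr.
by rewrite cE scalemxAr.
Qed.

(** By the intertwining relations, [A] and [A'] act on the columns of [U] and
    of [E *m U] through the same matrix [B], so the evolution of a column
    of [U] commutes with [E]; the left inverse [E'] brings an equation in the
    larger space back. *)
Lemma fractional_revival_transfer (R : realType) (m n k : nat)
    (A : 'M[R]_n) (A' : 'M[R]_m) (E : 'M[R]_(m, n)) (E' : 'M[R]_(n, m))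
    (U : 'M[R]_(n, k)) (B : 'M[R]_k) (a b : 'I_k) :
  E' *m E = 1%:M -> A *m U = U *m B -> A' *m (E *m U) = E *m (A *m U) ->
  fractional_revival A (complexify (col a U)) (complexify (col b U)) <->
  fractional_revival A' (complexify (E *m col a U)) (complexify (E *m col b U)).
Proof.
move=> E'E AU AEU.
have cE'E : complexify E' *m complexify E = 1%:M.
  by rewrite -complexifyM E'E /complexify map_mx1.
have trE t : transition_mx A' t *m (complexify E *m complexify (col a U)) =
             complexify E *m (transition_mx A t *m complexify (col a U)).
  have EUB : A' *m (E *m U) = (E *m U) *m B by rewrite AEU AU mulmxA.
  rewrite -complexifyM colE [E *m _]mulmxA !(complexifyM _ (delta_mx a 0)).
  rewrite mulmxA (transition_mx_intertwine t EUB).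
  rewrite [_ *m (complexify U *m _)]mulmxA (transition_mx_intertwine t AU).
  by rewrite complexifyM !mulmxA.
rewrite /fractional_revival !complexifyM (free_pair_mulmx _ _ cE'E).
split=> -[fr [t [x [y [y0 tE]]]]]; split=> //; exists t, x, y; split=> //.
  by rewrite trE tE mulmxDr !scalemxAr.
rewrite -[LHS]mul1mx -cE'E -mulmxA -trE tE.
by rewrite mulmxDr -!scalemxAr !mulmxA cE'E !mul1mx.
Qed.

(** * The invariant span of the block states *)

Lemma mul_mxsub_bij (R : pzSemiRingType) (m n p : nat) (g : 'I_m -> 'I_n)
    (A : 'M[R]_n) (V : 'M[R]_(n, p)) :
  bijective g -> mxsub g g A *m rowsub g V = rowsub g (A *m V).
Proof.
move=> gbij; apply/matrixP => i j; rewrite !mxE.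
rewrite [RHS](reindex g); last exact: onW_bij.
by apply: eq_bigr => l _; rewrite !mxE.
Qed.

(** The product with a vector supported on block [j] only sees the blocks of
    column [j] of [A], and each of these keeps [w j] on the line of the [w]
    attached to its row. *)
Lemma mul_mxcol_single (R : comPzRingType) (k : nat) (n : 'I_k -> nat)
    (A : 'M[R]_(\sum_i n i)) (w : forall j, 'cV[R]_(n j)) (B : 'M[R]_k) :
  (forall i j, submxblock A i j *m w j = B i j *: w i) ->
  forall j, A *m \mxcol_i ((i == j)%:R *: w i) =
    \sum_i B i j *: \mxcol_l ((l == i)%:R *: w l).
Proof.
move=> AB j; rewrite -{1}[A]submxblockK mul_mxblock_mxrow.
have -> : \sum_i B i j *: \mxcol_l ((l == i)%:R *: w l) =
    \mxcol_l (B l j *: w l).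
  transitivity (\sum_i \mxcol_l (B i j *: ((l == i)%:R *: w l))).
    by apply: eq_bigr => i _; apply/matrixP => x y; rewrite !mxE.
  rewrite -[LHS]mxcol_sum; apply: eq_mxcol => l; rewrite (bigD1 l) //= big1.
    by rewrite eqxx scale1r addr0.
  by move=> i /negPf il; rewrite eq_sym il scale0r scaler0.
apply: eq_mxcol => i; rewrite -AB (bigD1 j) //= big1 => [|l /negPf lj].
  by rewrite eqxx scale1r addr0.
by rewrite lj scale0r mulmx0.
Qed.

Definition state_mx (R : pzRingType) (m k : nat) (u : 'I_k -> 'cV[R]_m) :
    'M[R]_(m, k) :=
  \matrix_(x, j) u j x 0.

Lemma col_state_mx (R : pzRingType) (m k : nat) (u : 'I_k -> 'cV[R]_m) j :
  col j (state_mx u) = u j.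
Proof. by apply/colP => x; rewrite !mxE. Qed.

Lemma mul_state_mx (R : comPzRingType) (m k : nat) (A : 'M[R]_m)
   (u : 'I_k -> 'cV[R]_m) (B : 'M[R]_k) :
  (forall j, A *m u j = \sum_i B i j *: u i) ->
  A *m state_mx u = state_mx u *m B.
Proof.
move=> AB; apply/matrixP => x j; have /colP/(_ x) := AB j.
rewrite !mxE summxE => ABx.
under eq_bigr do rewrite mxE.
by rewrite ABx; apply: eq_bigr => i _; rewrite !mxE mulrC.
Qed.

Lemma mul_block_state (R : comPzRingType) (G : sgraph) (k : nat)
    (n : 'I_k -> nat) (pos : G -> 'I_(\sum_j n j)) (A : 'M[R]_#|G|)
    (N : 'M[R]_(\sum_j n j)) (w : forall j, 'cV[R]_(n j)) (B : 'M[R]_k) :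
  bijective pos ->
  (forall x y, N (pos x) (pos y) = A (enum_rank x) (enum_rank y)) ->
  (forall i j, submxblock N i j *m w j = B i j *: w i) ->
  forall j, A *m block_state pos w j = \sum_i B i j *: block_state pos w i.
Proof.
move=> pos_bij NA NB j; rewrite /block_state.
have -> : A = mxsub (pos \o enum_val) (pos \o enum_val) N.
  by apply/matrixP => x y; rewrite mxE /= NA !enum_valK.
rewrite mul_mxsub_bij; last exact: bij_comp pos_bij (enum_val_bij G).
rewrite (mul_mxcol_single NB) raddf_sum; apply: eq_bigr => i _.
by rewrite /= linearZ.
Qed.

(** * Extension by zero to a larger graph *)

Definition extension_mx (R : pzRingType) (G X : sgraph) (f : G -> X) :
    'M[R]_(#|X|, #|G|) :=
  \matrix_(y, x) (f (enum_val x) == enum_val y)%:R.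

Lemma extend_by_zeroE (R : pzRingType) (G X : sgraph) (f : G -> X)
    (u : 'cV[R]_#|G|) :
  injective f -> extend_by_zero f u = extension_mx R f *m u.
Proof.
move=> f_inj; apply/colP => y; rewrite !mxE; case: pickP => [v /eqP fv|no].
  rewrite (bigD1 (enum_rank v)) //= big1 => [|x /negPf xv].
    by rewrite mxE enum_rankK fv eqxx mul1r addr0.
  rewrite mxE -fv (inj_eq f_inj) -[v]enum_rankK (inj_eq enum_val_inj) xv.
  by rewrite mul0r.
by rewrite big1 // => x _; rewrite mxE no mul0r.
Qed.

Lemma tr_extension_mxK (R : pzRingType) (G X : sgraph) (f : G -> X) :
  injective f -> (extension_mx R f)^T *m extension_mx R f = 1%:M.
Proof.
move=> f_inj; apply/matrixP => x z; rewrite !mxE.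
rewrite (bigD1 (enum_rank (f (enum_val x)))) //= big1 => [|y /negPf yx].
  rewrite !mxE enum_rankK eqxx mul1r addr0 (inj_eq f_inj).
  by rewrite (inj_eq enum_val_inj) eq_sym.
by rewrite !mxE -[f _]enum_rankK (inj_eq enum_val_inj) eq_sym yx mul0r.
Qed.

Lemma graph_mx_offdiag (R : pzRingType) c (G X : sgraph) (f : G -> X) x z :
  induced_subgraph f -> x != z ->
  graph_mx R c X (enum_rank (f x)) (enum_rank (f z)) =
  graph_mx R c G (enum_rank x) (enum_rank z).
Proof.
move=> [f_inj f_adj] xz.
by case: c; rewrite !mxE ?(inj_eq enum_rank_inj) ?(inj_eq f_inj)
  ?(negPf xz) !enum_rankK f_adj.
Qed.

Lemma graph_mx_nonadj (R : pzRingType) c (X : sgraph) (x y : X) :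
  x != y -> ~~ adj x y -> graph_mx R c X (enum_rank x) (enum_rank y) = 0.
Proof.
move=> xy /negPf nadj.
by case: c; rewrite !mxE ?(inj_eq enum_rank_inj) ?(negPf xy) !enum_rankK nadj
  ?subr0 ?addr0.
Qed.

(** The diagonal of the Laplacians records degrees, which agree in both graphs
    only at vertices without a neighbour outside the subgraph. *)
Lemma graph_mx_diag (R : pzRingType) c (G X : sgraph) (f : G -> X) x :
  induced_subgraph f -> (forall y, adj (f x) y -> y \in codom f) ->
  graph_mx R c X (enum_rank (f x)) (enum_rank (f x)) =
  graph_mx R c G (enum_rank x) (enum_rank x).
Proof.
move=> [f_inj f_adj] xin.
have degE : #|[set y | adj (f x) y]| = #|[set y | adj x y]|.
  rewrite -(card_imset _ f_inj); apply: eq_card => y; rewrite inE.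
  apply/idP/imsetP => [fxy|[z + ->]]; last by rewrite inE f_adj.
  have /codomP[z yz] := xin _ fxy; exists z => //.
  by rewrite inE -f_adj -yz.
by case: c; rewrite !mxE ?eqxx !enum_rankK ?degE f_adj.
Qed.

(** The equality holds term by term, for the contribution of each vertex [x]
    of [G]. If [x] has no neighbour outside [G], then column [x] of the matrix
    of [X] is that of [G] extended by zero; otherwise row [x] of [U] is zero. *)
Lemma graph_mx_extension (R : pzRingType) c (G X : sgraph) (f : G -> X)
    (k : nat) (U : 'M[R]_(#|G|, k)) :
  induced_subgraph f ->
  (forall x y, y \notin codom f -> adj (f x) y ->
    forall j, U (enum_rank x) j = 0) ->
  graph_mx R c X *m (extension_mx R f *m U) =
  extension_mx R f *m (graph_mx R c G *m U).
Proof.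
move=> find U0; have [f_inj f_adj] := find.
apply/matrixP => y' j; rewrite -(enum_valK y') !mulmxA !mxE.
set y := enum_val y'.
apply: eq_bigr => x' _; rewrite -(enum_valK x').
set x := enum_val x'.
have -> : (graph_mx R c X *m extension_mx R f) (enum_rank y) (enum_rank x) =
    graph_mx R c X (enum_rank y) (enum_rank (f x)).
  rewrite mxE (bigD1 (enum_rank (f x))) //= big1 => [|z /negPf zx].
    by rewrite mxE !enum_rankK eqxx mulr1 addr0.
  rewrite mxE enum_rankK -[f x]enum_rankK (inj_eq enum_val_inj).
  by rewrite eq_sym zx mulr0.
have [/codomP[z ->]|ynin] := boolP (y \in codom f).
  have -> : (extension_mx R f *m graph_mx R c G)
      (enum_rank (f z)) (enum_rank x) =
     graph_mx R c G (enum_rank z) (enum_rank x).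
    rewrite mxE (bigD1 (enum_rank z)) //= big1 => [|v /negPf vz].
      by rewrite mxE !enum_rankK eqxx mul1r addr0.
    rewrite mxE enum_rankK (inj_eq f_inj) -[z]enum_rankK (inj_eq enum_val_inj).
    by rewrite vz mul0r.
  have [->|zx] := eqVneq z x; last by rewrite graph_mx_offdiag.
  have [/existsP[v /andP[vnin fxv]]|/existsPn none] :=
     boolP [exists v, (v \notin codom f) && adj (f x) v].
    by rewrite (U0 _ _ vnin fxv) !mulr0.
  rewrite graph_mx_diag // => v fxv; move: (none v).
  by rewrite fxv andbT negbK.
have -> : (extension_mx R f *m graph_mx R c G) (enum_rank y) (enum_rank x) = 0.
  rewrite mxE big1 // => v _; rewrite mxE enum_rankK.
  case: eqP => [fy|]; last by rewrite mul0r.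
  by rewrite -fy codom_f in ynin.
rewrite mul0r.
have [fxy|nadj] := boolP (adj (f x) y);
  first by rewrite (U0 _ _ ynin fxy) mulr0.
rewrite graph_mx_nonadj ?mul0r //; last by rewrite adj_sym.
by apply: contraNneq ynin => ->; rewrite codom_f.
Qed.

Theorem corollary1 (R : realType) (G : sgraph) (c : graph_mx_kind)
    (k : nat) (n : 'I_k -> nat)
    (pos : G -> 'I_(\sum_(j < k) n j))
    (N : 'M[R]_(\sum_(j < k) n j))
    (M : forall j : 'I_k, 'M[R]_(n j))
    (C : forall i j : 'I_k, 'M[R]_(n i, n j))
    (w : forall j : 'I_k, 'cV[R]_(n j))
    (lambda : 'I_k -> R) (alpha beta : 'I_k -> 'I_k -> R)
    (hpos : bijective pos)
    (hN : forall x y : G,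
       N (pos x) (pos y) = graph_mx R c G (enum_rank x) (enum_rank y))
    (hMsym : forall j : 'I_k, (M j)^T = M j)
    (hdiag : forall j : 'I_k, submxblock N j j = M j)
    (hupper : forall i j : 'I_k, (i < j)%N -> submxblock N i j = C i j)
    (hlower : forall i j : 'I_k, (i < j)%N -> submxblock N j i = (C i j)^T)
    (hw : forall j : 'I_k, w j != 0)
    (hM : forall j : 'I_k, M j *m w j = lambda j *: w j)
    (hC : forall i j : 'I_k, (i < j)%N -> C i j *m w j = alpha i j *: w i)
    (hCT : forall i j : 'I_k, (i < j)%N ->
       (C i j)^T *m w i = beta i j *: w j)
    (hunit : forall j : 'I_k,
       Num.sqrt (\sum_i block_state pos w j i 0 ^+ 2) = 1)
    (X : sgraph) (f : G -> X) (hf : induced_subgraph f)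
    (hS : forall (x : G) (y : X), y \notin codom f -> adj (f x) y ->
       x \in common_zeros (block_state pos w))
    (a b : 'I_k) (hab : a != b) :
  fractional_revival (graph_mx R c G)
    (complexify (block_state pos w a)) (complexify (block_state pos w b)) <->
  fractional_revival (graph_mx R c X)
    (complexify (extend_by_zero f (block_state pos w a)))
    (complexify (extend_by_zero f (block_state pos w b))).
Proof.
(* For [j < i] the block in position [(i, j)] is the transpose of [C j i], so
   its coefficient is [beta j i]. *)
pose B := \matrix_(i, j) (if (i < j)%N then alpha i j
                          else if (j < i)%N then beta j i else lambda i).
have NB i j : submxblock N i j *m w j = B i j *: w i.
  rewrite mxE; case: ltngtP => [ij|ji|/val_inj <-].
  - by rewrite hupper // hC.
  - by rewrite hlower // hCT.
  - by rewrite hdiag hM.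
have [f_inj _] := hf.
rewrite !extend_by_zeroE // -!(col_state_mx (block_state pos w)).
apply: (@fractional_revival_transfer _ _ _ _ _ _ _ _ _ B).
- exact: tr_extension_mxK.
- exact/mul_state_mx/(mul_block_state hpos hN NB).
- apply: graph_mx_extension => // x y ynin fxy j.
  have := hS x y ynin fxy; rewrite inE => /forallP/(_ j)/eqP.
  by move=> uj0; rewrite mxE uj0.
Qed.
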